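(* Let $p\ge 1$ and, for density matrices $\rho,\sigma$ on a finite-dimensional complex Hilbert space, define $$\mathcal{F}_p(\rho,\sigma)=\frac{\|\sqrt{\rho}\sqrt{\sigma}\|_p^{2}}{\max[\|\sigma\|_p^{2},\|\rho\|_p^{2}]},\qquad \|A\|_p=\left(\operatorname{tr}\big[(AA^{\dagger})^{p/2}\big]\right)^{1/p}.$$ Then for all density matrices $\rho,\sigma$ on that space: (J1a) $\mathcal{F}_p(\rho,\sigma)\in[0,1]$; (J1b) $\mathcal{F}_p(\rho,\sigma)=1$ if and only if $\rho=\sigma$; (J1c) $\mathcal{F}_p(\rho,\sigma)=0$ if and only if $\rho\sigma=0$; (J2) $\mathcal{F}_p(\rho,\sigma)=\mathcal{F}_p(\sigma,\rho)$; (J3) $\mathcal{F}_p(\rho,\sigma)=\operatorname{tr}(\rho\sigma)$ whenever $\rho$ or $\sigma$ is a pure state (a rank-one projector); (J4) $\mathcal{F}_p(U\rho U^{\dagger},U\sigma U^{\dagger})=\mathcal{F}_p(\rho,\sigma)$ for every unitary $U$.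
   Context: A density matrix is a positive semidefinite operator of unit trace; $\sqrt{\rho}$ denotes the positive semidefinite square root. $\|\cdot\|_p$ is the Schatten $p$-norm. *)

(* Defs.v *)
From HB Require Import structures.
From mathcomp Require Import all_boot all_order all_algebra.
From mathcomp Require Import sesquilinear spectral.
From mathcomp Require Import complex.
From mathcomp Require Import reals exp.

Set Implicit Arguments.
Unset Strict Implicit.
Unset Printing Implicit Defensive.

Import Order.TTheory GRing.Theory Num.Theory.
Local Open Scope ring_scope.
Local Open Scope complex_scope.

Section QFid.
Variable R : realType.
Local Notation C := (R[i]).

Definition adj m n (A : 'M[C]_(m, n)) : 'M[C]_(n, m) := map_mx conjc (A^T).

Definition psd n (A : 'M[C]_n) : Prop :=
  adj A = A /\ forall v : 'rV[C]_n, 0 <= (v *m A *m adj v) 0 0.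

Definition density n (A : 'M[C]_n) : Prop := psd A /\ \tr A = 1.

Definition pure_state n (A : 'M[C]_n) : Prop :=
  adj A = A /\ A *m A = A /\ \rank A = 1%N.

Definition unitary n (U : 'M[C]_n) : Prop := U *m adj U = 1%:M.

(* functional calculus for a normal matrix A = P^-1 diag(d) P (P unitary):
   f(A) := P^-1 diag(f d) P *)
Definition mxfunc n (f : C -> C) (A : 'M[C]_n) : 'M[C]_n :=
  invmx (spectralmx A) *m diag_mx (map_mx f (spectral_diag A)) *m spectralmx A.

Definition sqrtm n (A : 'M[C]_n) : 'M[C]_n := mxfunc (fun z => sqrtC z) A.

Definition mxpowR n (A : 'M[C]_n) (t : R) : 'M[C]_n :=
  mxfunc (fun z => (powR (complex.Re z) t)%:C) A.

Definition schatten n (p : R) (A : 'M[C]_n) : R :=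
  powR (complex.Re (\tr (mxpowR (A *m adj A) (p / 2)))) (1 / p).

Definition Fp n (p : R) (rho sigma : 'M[C]_n) : R :=
  schatten p (sqrtm rho *m sqrtm sigma) ^+ 2 /
  Num.max (schatten p sigma ^+ 2) (schatten p rho ^+ 2).

End QFid.

(* Main.v *)
(* Write [A = sqrt rho], [B = sqrt sigma], let [s_i] be the singular values of
   [A B] and [u_i], [v_i] its left and right singular vectors (as rows). Then
   [s_i] is the inner product of [u_i A] and [v_i B], so
     [2 s_i = a_i + b_i - |u_i A - v_i B|^2],
   with [a_i], [b_i] the diagonal entries of [rho], [sigma] at [u_i], [v_i].
   Convexity of [x^p] and Peierls' inequality give
     [sum s_i^p <= sum ((a_i + b_i)/2)^p <= (tr rho^p + tr sigma^p)/2].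
   Equality forces [u_i A = v_i B] for all [i], hence [rho = B V^+ V B <= sigma]
   for the partial isometry [V] with rows [v_i], and [rho = sigma] because the
   traces agree. *)

Require Import Defs.
From HB Require Import structures.
From mathcomp Require Import all_boot all_order all_algebra.
From mathcomp Require Import sesquilinear spectral.
From mathcomp Require Import complex.
From mathcomp Require Import reals exp.
From mathcomp Require Import ring lra.
Import Order.TTheory GRing.Theory Num.Theory.
Local Open Scope ring_scope.
Local Open Scope complex_scope.

Set Implicit Arguments.
Unset Strict Implicit.
Unset Printing Implicit Defensive.

(** * Adjoints, unitaries and squared row norms *)

Section Adjoint.
Variable R : realType.
Local Notation C := R[i].

Lemma adjE m n (A : 'M[C]_(m, n)) : adj A = map_mx Num.conj A^T.
Proof. by []. Qed.

Lemma adjK m n (A : 'M[C]_(m, n)) : adj (adj A) = A.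
Proof. by apply/matrixP => i j; rewrite !mxE conjcK. Qed.

Lemma adjM m n q (A : 'M[C]_(m, n)) (B : 'M[C]_(n, q)) :
  adj (A *m B) = adj B *m adj A.
Proof. by rewrite !adjE trmx_mul map_mxM. Qed.

Lemma adjB m n (A B : 'M[C]_(m, n)) : adj (A - B) = adj A - adj B.
Proof. by rewrite !adjE linearB /= map_mxB. Qed.

Lemma unitary_spectralmx n (A : 'M[C]_n) : unitary (spectralmx A).
Proof. exact/unitarymxP/spectral_unitarymx. Qed.

Lemma invmx_unitary_adj n (U : 'M[C]_n) : unitary U -> invmx U = adj U.
Proof. by move=> /unitarymxP; exact: invmx_unitary. Qed.

Lemma normalmx_spectralE n (A : 'M[C]_n) : adj A *m A = A *m adj A ->
  A = adj (spectralmx A) *m diag_mx (spectral_diag A) *m spectralmx A.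
Proof.
move=> hA; rewrite -invmx_unitary_adj; last exact: unitary_spectralmx.
exact/orthomx_spectralP/normalmxP.
Qed.

Lemma mxfuncE n (f : C -> C) (A : 'M[C]_n) :
  mxfunc f A = adj (spectralmx A) *m diag_mx (map_mx f (spectral_diag A)) *m spectralmx A.
Proof. by rewrite /mxfunc invmx_unitary_adj; last exact: unitary_spectralmx. Qed.

Lemma unitaryC n (U : 'M[C]_n) : unitary U -> adj U *m U = 1%:M.
Proof. exact: mulmx1C. Qed.

Lemma unitary_adj n (U : 'M[C]_n) : unitary U -> unitary (adj U).
Proof. by rewrite /unitary adjK => /unitaryC. Qed.

Lemma unitaryM n (U V : 'M[C]_n) : unitary U -> unitary V -> unitary (U *m V).
Proof.
by rewrite /unitary => hU hV; rewrite adjM mulmxA -(mulmxA U) hV mulmx1.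
Qed.

(** The squared modulus valued in [R] rather than [C], so that it can serve as a weight in the real
    [powR] inequalities. *)
Definition normsq (z : C) : R := complex.Re z ^+ 2 + complex.Im z ^+ 2.

Lemma normsq_ge0 z : 0 <= normsq z.
Proof. by rewrite addr_ge0 ?sqr_ge0. Qed.

Lemma normsq_eq0 z : (normsq z == 0) = (z == 0).
Proof. by rewrite paddr_eq0 ?sqr_ge0 // !sqrf_eq0 eq_complex. Qed.

Lemma mulcJ z : z * z^* = (normsq z)%:C.
Proof.
case: z => a b; rewrite /normsq /=; apply/eqP; rewrite eq_complex /=.
by apply/andP; split; apply/eqP; ring.
Qed.

Lemma mulmx_adj_diag m n (X : 'M[C]_(m, n)) i :
  (X *m adj X) i i = (\sum_j normsq (X i j))%:C.
Proof. by rewrite mxE rmorph_sum; apply: eq_bigr => j _; rewrite !mxE mulcJ. Qed.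

Lemma mulmx_adj_diag_eq0 m n (X : 'M[C]_(m, n)) :
  (forall i, (X *m adj X) i i = 0) -> X = 0.
Proof.
move=> h; apply/matrixP => i j; move: (h i).
rewrite mulmx_adj_diag mxE => /complexI/eqP; rewrite psumr_eq0 => [/allP/(_ j)|k _];
  last exact: normsq_ge0.
by rewrite mem_index_enum normsq_eq0 => /(_ isT)/eqP.
Qed.

Lemma mulmx_adj_eq0 m n (X : 'M[C]_(m, n)) : X *m adj X = 0 -> X = 0.
Proof. by move=> h; apply: mulmx_adj_diag_eq0 => i; rewrite h mxE. Qed.

Lemma mxtrace_mulmx_adj_eq0 m n (X : 'M[C]_(m, n)) : \tr (X *m adj X) = 0 -> X = 0.
Proof.
move=> h; apply: mulmx_adj_diag_eq0 => i.
move/eqP: h; rewrite psumr_eq0 => [/allP/(_ i)|k _].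
  by rewrite mem_index_enum => /(_ isT)/eqP.
by rewrite mulmx_adj_diag lecR sumr_ge0 // => j _; exact: normsq_ge0.
Qed.

End Adjoint.

(** * Functional calculus, independent of the diagonalization *)

Section FunctionalCalculus.
Variable R : realType.
Local Notation C := R[i].

Definition rdiag n (d : 'I_n -> R) : 'M[C]_n := diag_mx (\row_i (d i)%:C).

Lemma rdiagE n (d : 'I_n -> R) i j : rdiag d i j = (d i)%:C *+ (i == j).
Proof. by rewrite !mxE. Qed.

Lemma mul_rdiagl m n (d : 'I_n -> R) (X : 'M[C]_(n, m)) i j :
  (rdiag d *m X) i j = (d i)%:C * X i j.
Proof. by rewrite mul_diag_mx !mxE. Qed.

Lemma adj_rdiag n (d : 'I_n -> R) : adj (rdiag d) = rdiag d.
Proof.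
apply/matrixP => i j; rewrite !mxE eq_sym; case: eqP => [->|_].
  by rewrite !mulr1n conjc_real.
by rewrite !mulr0n conjc0.
Qed.

Lemma mul_rdiag n (d e : 'I_n -> R) : rdiag d *m rdiag e = rdiag (fun i => d i * e i).
Proof. by apply/matrixP => i j; rewrite mul_rdiagl !rdiagE rmorphM mulrnAr. Qed.

Lemma eq_rdiag n (d e : 'I_n -> R) : d =1 e -> rdiag d = rdiag e.
Proof. by move=> de; apply/matrixP => i j; rewrite !rdiagE de. Qed.

Lemma mxtrace_rdiag n (d : 'I_n -> R) : \tr (rdiag d) = (\sum_i d i)%:C.
Proof. by rewrite rmorph_sum; apply: eq_bigr => i _; rewrite rdiagE eqxx mulr1n. Qed.

(** The rows of [P] are left eigenvectors. Any real diagonalization is allowed, not only the one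
    chosen by [spectralmx], so that one [P] can serve several matrices. *)
Definition diagonalizes n (P : 'M[C]_n) (d : 'I_n -> R) (A : 'M[C]_n) :=
  unitary P /\ A = adj P *m rdiag d *m P.

Lemma diagonalizes_adj n (P : 'M[C]_n) d A : diagonalizes P d A -> adj A = A.
Proof. by move=> [_ ->]; rewrite !adjM adjK adj_rdiag mulmxA. Qed.

Lemma diagonalizes_mul n (P : 'M[C]_n) d e A B :
  diagonalizes P d A -> diagonalizes P e B ->
  diagonalizes P (fun i => d i * e i) (A *m B).
Proof.
move=> [hP ->] [_ ->]; split=> //.
by rewrite -!mulmxA (mulmxA P) hP mul1mx !mulmxA -(mulmxA (adj P)) mul_rdiag.
Qed.

Lemma diagonalizes_conj n (U P : 'M[C]_n) d A : unitary U ->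
  diagonalizes P d A -> diagonalizes (P *m adj U) d (U *m A *m adj U).
Proof.
move=> hU [hP ->]; split; first exact/unitaryM/unitary_adj.
by rewrite adjM adjK !mulmxA.
Qed.

Lemma diagonalizes_trace n (P : 'M[C]_n) d A :
  diagonalizes P d A -> \tr A = (\sum_i d i)%:C.
Proof. by move=> [hP ->]; rewrite mxtrace_mulC mulmxA hP mul1mx mxtrace_rdiag. Qed.

(** Entrywise the hypothesis reads [d_i Y_ij = Y_ij e_j], so either [Y_ij = 0] or [d_i = e_j]; hence
    [f] may be arbitrary. *)
Lemma intertwine_diag n m (f : C -> C) (d : 'rV[C]_n) (e : 'rV[C]_m) (Y : 'M[C]_(n, m)) :
  diag_mx d *m Y = Y *m diag_mx e ->
  diag_mx (map_mx f d) *m Y = Y *m diag_mx (map_mx f e).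
Proof.
move=> h; apply/matrixP => i j; move/matrixP/(_ i j): h.
rewrite !mul_diag_mx !mul_mx_diag !mxE mulrC => /eqP.
rewrite -subr_eq0 -mulrBr mulf_eq0 => /orP[/eqP->|]; first by rewrite mulr0 mul0r.
by rewrite subr_eq0 => /eqP->; rewrite mulrC.
Qed.

(** Passing to [P X Q^+] reduces this to diagonal matrices. *)
Lemma intertwine n (P Q X : 'M[C]_n) (f : C -> C) d e : unitary P -> unitary Q ->
  adj P *m diag_mx d *m P *m X = X *m (adj Q *m diag_mx e *m Q) ->
  adj P *m diag_mx (map_mx f d) *m P *m X = X *m (adj Q *m diag_mx (map_mx f e) *m Q).
Proof.
move=> hP hQ h.
have /(intertwine_diag f) : diag_mx d *m (P *m X *m adj Q) = (P *m X *m adj Q) *m diag_mx e.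
  have := congr1 (fun M => P *m M *m adj Q) h.
  by rewrite -!mulmxA hQ mulmx1 !mulmxA hP mul1mx => ->.
move/(congr1 (fun M => adj P *m M *m Q)).
by rewrite -!mulmxA (unitaryC hQ) mulmx1 !mulmxA (unitaryC hP) mul1mx.
Qed.

Lemma diagonalizes_normal n (P : 'M[C]_n) d A : diagonalizes P d A ->
  A = adj (spectralmx A) *m diag_mx (spectral_diag A) *m spectralmx A.
Proof.
by move=> h; apply: normalmx_spectralE; rewrite (diagonalizes_adj h).
Qed.

(** Intertwining with [X = 1] carries the spectral decomposition chosen by [mxfunc] to the given
    one. *)
Lemma mxfunc_diag n (P : 'M[C]_n) d (A : 'M[C]_n) (f : C -> C) : diagonalizes P d A ->
  mxfunc f A = adj P *m diag_mx (\row_i f (d i)%:C) *m P.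
Proof.
move=> h; have hA := diagonalizes_normal h; case: h => hP hd.
rewrite mxfuncE; move: (unitary_spectralmx A) hA.
move: (spectralmx A) (spectral_diag A) => S e hS hA.
have := @intertwine _ S P 1%:M f e (\row_i (d i)%:C) hS hP.
rewrite !mulmx1 !mul1mx => ->; last by rewrite -hA.
by congr (_ *m diag_mx _ *m _); apply/matrixP => i j; rewrite !mxE.
Qed.

Lemma mxfunc_rdiag n (P : 'M[C]_n) d (A : 'M[C]_n) (f : C -> C) (g : R -> R) :
  diagonalizes P d A -> (forall i, f (d i)%:C = (g (d i))%:C) ->
  diagonalizes P (g \o d) (mxfunc f A).
Proof.
move=> h fg; rewrite (mxfunc_diag f h); case: h => hP _; split=> //.
by congr (_ *m diag_mx _ *m _); apply/matrixP => i j; rewrite !mxE.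
Qed.

Lemma mxpowR_diag n (P : 'M[C]_n) d (A : 'M[C]_n) t :
  diagonalizes P d A -> diagonalizes P (fun i => powR (d i) t) (mxpowR A t).
Proof.
move=> h; rewrite /mxpowR.
apply: (@mxfunc_rdiag n P d A (fun z => (powR (complex.Re z) t)%:C)
  (fun x => powR x t) h (fun=> erefl)).
Qed.

Lemma sqrtC_real (x : R) : 0 <= x -> sqrtC (x%:C : C) = (Num.sqrt x)%:C.
Proof.
move=> x0; apply/eqP; rewrite -(eqrXn2 (n := 2)) // ?sqrtC_ge0 ?lecR ?sqrtr_ge0 //.
by rewrite sqrtCK -rmorphXn /= sqr_sqrtr.
Qed.

Lemma sqrtm_diag n (P : 'M[C]_n) d (A : 'M[C]_n) : (forall i, 0 <= d i) ->
  diagonalizes P d A -> diagonalizes P (fun i => Num.sqrt (d i)) (sqrtm A).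
Proof.
move=> d0 h; rewrite /sqrtm.
apply: (@mxfunc_rdiag n P d A (fun z => sqrtC z) Num.sqrt h) => i; exact: sqrtC_real.
Qed.

Lemma psd_diagonalizes n (A : 'M[C]_n) : psd A ->
  exists P d, diagonalizes P d A /\ forall i, 0 <= d i.
Proof.
move=> [hA pA]; have hS := unitary_spectralmx A.
have eA : A = adj (spectralmx A) *m diag_mx (spectral_diag A) *m spectralmx A.
  by apply: normalmx_spectralE; rewrite hA.
(* The quadratic form of [A] at the [i]-th row of [spectralmx A] is the [i]-th eigenvalue. *)
have d0 i : 0 <= spectral_diag A 0 i.
  have := pA (row i (spectralmx A)).
  suff -> : (row i (spectralmx A) *m A *m adj (row i (spectralmx A))) 0 0
      = spectral_diag A 0 i by [].
  have -> : adj (row i (spectralmx A)) = col i (adj (spectralmx A)).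
    by apply/matrixP => j k; rewrite !mxE.
  rewrite -row_mul colE mulmxA -row_mul {2}eA !mulmxA hS mul1mx.
  by rewrite -mulmxA hS mulmx1 -colE !mxE eqxx mulr1n.
exists (spectralmx A), (fun i => complex.Re (spectral_diag A 0 i)); split.
  split=> //; rewrite {1}eA; congr (_ *m diag_mx _ *m _).
  by apply/matrixP => i j; rewrite ord1 !mxE RRe_real // ger0_real.
by move=> i; have := d0 i; rewrite lecE => /andP[].
Qed.

Lemma psd_mulmx_adj n (X : 'M[C]_n) : psd (X *m adj X).
Proof.
split; first by rewrite adjM adjK.
move=> v; rewrite mulmxA -mulmxA -adjM mulmx_adj_diag lecR.
by apply: sumr_ge0 => j _; exact: normsq_ge0.
Qed.

End FunctionalCalculus.

(** * Convexity of powers and substochastic averages *)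

Section PowerInequalities.
Variable R : realType.
Implicit Types (p x c : R).

(** Young's inequality for [x] and [c^(p-1)] with exponents [p] and [p/(p-1)]. The case [p = 1],
    where the second exponent degenerates, is separate. *)
Lemma powR_tangent p x c : 1 <= p -> 0 <= x -> 0 <= c ->
  powR c p + p * powR c (p - 1) * (x - c) <= powR x p.
Proof.
move=> p1 x0 c0; have p0 : 0 < p by lra.
rewrite mulrBr -[_ * c]mulrA [_ * c]mulrC mulr_powRB1 //.
have [->|pn1] := eqVneq p 1.
  by rewrite subrr powRr0 !powRr1 //; lra.
have p1' : 0 < p - 1 by rewrite subr_gt0 lt_neqAle eq_sym pn1.
have := @conjugate_powR _ x (powR c (p - 1)) p (p / (p - 1)) x0 (powR_ge0 _ _) p0 (divr_gt0 p0 p1').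
rewrite -powRrM mulrCA divff ?gt_eqF // mulr1.
have -> : p^-1 + (p / (p - 1))^-1 = 1 by field; rewrite !gt_eqF.
move=> /(_ erefl); rewrite -(ler_pM2l p0) => h.
have e : p * (powR x p / p + powR c p / (p / (p - 1))) = powR x p + (p - 1) * powR c p.
  by field; rewrite !gt_eqF.
by move: h; rewrite e; lra.
Qed.

(** Jensen's inequality, by summing the tangents at the weighted sum [c]. Total weight [W <= 1]
    suffices: the shortfall leaves a term [(1 - W)(p - 1) c^p >= 0]. *)
Lemma powR_subconvex (I : finType) p (w x : I -> R) : 1 <= p ->
  (forall i, 0 <= w i) -> (forall i, 0 <= x i) -> \sum_i w i <= 1 ->
  powR (\sum_i w i * x i) p <= \sum_i w i * powR (x i) p.
Proof.
move=> p1 w0 x0 w1; set c := \sum_i _ * x _.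
have c0 : 0 <= c by apply: sumr_ge0 => i _; rewrite mulr_ge0.
have p0 : 0 < p by lra.
apply: le_trans (_ : \sum_i w i * (powR c p + p * powR c (p - 1) * (x i - c)) <= _); last first.
  by apply: ler_sum => i _; rewrite ler_wpM2l // powR_tangent.
rewrite (eq_bigr (fun i => w i * (powR c p - p * (c * powR c (p - 1))) +
  p * powR c (p - 1) * (w i * x i))); last by move=> i _; ring.
rewrite big_split /= -mulr_sumr -mulr_suml -/c -[_ * c]mulrA [_ * c]mulrC mulr_powRB1 //.
rewrite -subr_ge0 in w1; have p1' : 0 <= p - 1 by lra.
by have := mulr_ge0 (mulr_ge0 w1 p1') (powR_ge0 c p); lra.
Qed.

(** Jensen in each row, then exchange of sums and the column bound. *)
Lemma sum_powR_substochastic (I J : finType) p (w : I -> J -> R) (x : J -> R) :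
  1 <= p -> (forall i j, 0 <= w i j) -> (forall j, 0 <= x j) ->
  (forall i, \sum_j w i j <= 1) -> (forall j, \sum_i w i j <= 1) ->
  \sum_i powR (\sum_j w i j * x j) p <= \sum_j powR (x j) p.
Proof.
move=> p1 w0 x0 wr wc.
apply: le_trans (_ : \sum_i \sum_j w i j * powR (x j) p <= _).
  by apply: ler_sum => i _; apply: powR_subconvex.
rewrite exchange_big; apply: ler_sum => j _; rewrite -mulr_suml.
by rewrite ler_piMl ?powR_ge0.
Qed.

Lemma powR_midpoint p (x y : R) : 1 <= p -> 0 <= x -> 0 <= y ->
  powR ((x + y) / 2) p <= (powR x p + powR y p) / 2.
Proof.
move=> p1 x0 y0.
have := @powR_subconvex bool p (fun=> 2^-1) (fun b => if b then x else y) p1.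
rewrite !big_bool /= -!mulrDr ![2^-1 * _]mulrC; apply; [by move=> _; rewrite invr_ge0|by case|].
by rewrite -[2^-1]mul1r -splitr.
Qed.

Lemma powR_sqrt (x p : R) : 0 <= x -> powR (Num.sqrt x) p = powR x (p / 2).
Proof. by move=> x0; rewrite -powR12_sqrt // -powRrM mulrC. Qed.

Lemma powR_sqr_half (x p : R) : 0 <= x -> powR (x * x) (p / 2) = powR x p.
Proof. by move=> x0; rewrite -powR_sqrt ?mulr_ge0 // -expr2 sqrtr_sqr ger0_norm. Qed.

End PowerInequalities.

(** * Schatten norms from eigenvalues *)

Section Schatten.
Variable R : realType.
Local Notation C := R[i].

(** The [d i] are squared singular values of [X], hence the exponent [p / 2]. *)
Lemma schatten_diag n p (X P : 'M[C]_n) d : diagonalizes P d (X *m adj X) ->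
  schatten p X = powR (\sum_i powR (d i) (p / 2)) (1 / p).
Proof. by move=> h; rewrite /schatten (diagonalizes_trace (mxpowR_diag _ h)). Qed.

Lemma schatten_hermitian n p (A P : 'M[C]_n) d : diagonalizes P d A ->
  (forall i, 0 <= d i) -> schatten p A = powR (\sum_i powR (d i) p) (1 / p).
Proof.
move=> h d0; rewrite (@schatten_diag _ _ _ P (fun i => d i * d i)).
  by congr powR; apply: eq_bigr => i _; rewrite powR_sqr_half.
by rewrite (diagonalizes_adj h); apply: diagonalizes_mul.
Qed.

(* With [g x = x^(p/2) / x], intertwining [X X^+] and [X^+ X] through [X] gives
   [tr (g(X X^+) X X^+) = tr (X g(X^+ X) X^+) = tr (g(X^+ X) X^+ X)]. *)
Lemma schatten_adj n p (X : 'M[C]_n) : 0 < p -> schatten p (adj X) = schatten p X.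
Proof.
move=> p0.
have [P [d [hd d0]]] := psd_diagonalizes (psd_mulmx_adj X).
have [Q [e [he e0]]] := psd_diagonalizes (psd_mulmx_adj (adj X)).
rewrite (schatten_diag _ hd) (schatten_diag _ he); congr powR.
pose g (x : R) := powR x (p / 2) / x.
have gE x : g x * x = powR x (p / 2).
  rewrite /g; have [->|xn0] := eqVneq x 0; last by rewrite divfK.
  (* At [x = 0] both sides vanish, since [p > 0] gives [powR 0 (p / 2) = 0]. *)
  by rewrite mulr0 powR0 // gt_eqF // divr_gt0.
have hgd : diagonalizes P (g \o d) (adj P *m rdiag (g \o d) *m P) by split=> //; case: hd.
have hge : diagonalizes Q (g \o e) (adj Q *m rdiag (g \o e) *m Q) by split=> //; case: he.
rewrite adjK in he.
have key : adj P *m rdiag (g \o d) *m P *m X = X *m (adj Q *m rdiag (g \o e) *m Q).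
  have := @intertwine _ n P Q X (fun z => (g (complex.Re z))%:C)
    (\row_i (d i)%:C) (\row_i (e i)%:C).
  have mapE f : map_mx (fun z => (g (complex.Re z))%:C) (\row_i (f i)%:C : 'rV[C]_n)
    = \row_i (g (f i))%:C by apply/matrixP => i j; rewrite !mxE.
  rewrite !mapE; case: hd => hP hd; case: he => hQ he; apply=> //.
  (* The intertwining relation to check is [(X X^+) X = X (X^+ X)]. *)
  by rewrite -!/(rdiag _) -hd -he mulmxA.
apply: (@complexI R).
rewrite -(eq_bigr _ (fun i _ => gE (d i))) -(eq_bigr _ (fun i _ => gE (e i))).
rewrite -(diagonalizes_trace (diagonalizes_mul hgd hd)).
rewrite -(diagonalizes_trace (diagonalizes_mul hge he)).
rewrite [X in _ = \tr X]mulmxA key.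
by rewrite -[X in _ = \tr X]mulmxA [RHS]mxtrace_mulC -[X in _ = \tr X]mulmxA.
Qed.

End Schatten.

(** * Peierls' inequality and singular vectors *)

Section TraceInequality.
Variable R : realType.
Local Notation C := R[i].

Lemma normsq_conj (z : C) : normsq z^* = normsq z.
Proof. by case: z => a b; rewrite /normsq /= sqrrN. Qed.

(** [E = W W^+] is a projection, so its [i]-th row has squared norm [E_ii = x]. That squared norm
    contains the term [x^2], whence [x^2 <= x]. *)
Lemma partial_isometry_row_le1 n (W : 'M[C]_n) i : W *m adj W *m W = W ->
  \sum_j normsq (W i j) <= 1.
Proof.
move=> hW; set x := \sum_j _.
have x0 : 0 <= x by apply: sumr_ge0 => j _; exact: normsq_ge0.
set E := W *m adj W.
have hE : E *m adj E = E by rewrite /E adjM adjK mulmxA hW.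
have Eii : E i i = x%:C by exact: mulmx_adj_diag.
have : x = \sum_k normsq (E i k).
  by apply: (@complexI R); rewrite -Eii -{1}hE mulmx_adj_diag.
rewrite (bigD1 i) //= {1}Eii {1}/normsq /= expr0n addr0.
have : 0 <= \sum_(k | k != i) normsq (E i k).
  by apply: sumr_ge0 => j _; exact: normsq_ge0.
move: (\sum_(k | _) _) => y y0 xE; nra.
Qed.

Lemma partial_isometry_col_le1 n (W : 'M[C]_n) j : W *m adj W *m W = W ->
  \sum_i normsq (W i j) <= 1.
Proof.
move=> hW; have := @partial_isometry_row_le1 n (adj W) j.
under eq_bigr do rewrite !mxE normsq_conj.
by apply; have := congr1 (@adj R n n) hW; rewrite !adjM !adjK mulmxA.
Qed.

Lemma diag_conj n (P V A : 'M[C]_n) d i : diagonalizes P d A ->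
  (V *m A *m adj V) i i = (\sum_j normsq ((V *m adj P) i j) * d j)%:C.
Proof.
move=> [hP ->].
have -> : V *m (adj P *m rdiag d *m P) *m adj V = V *m adj P *m (rdiag d *m adj (V *m adj P)).
  by rewrite adjM adjK !mulmxA.
rewrite mxE rmorph_sum; apply: eq_bigr => j _.
by rewrite mul_rdiagl mulrCA [RHS]rmorphM /= -mulcJ mulrC [adj _ _ _]mxE [_^T _ _]mxE.
Qed.

(** Peierls' inequality for a partial isometry: [V P^+] is again one, so the squared moduli of its
    entries form a doubly substochastic matrix averaging the eigenvalues of [A]. *)
Lemma sum_powR_diag_le n p (P V A : 'M[C]_n) d : 1 <= p -> diagonalizes P d A ->
  (forall i, 0 <= d i) -> V *m adj V *m V = V ->
  \sum_i powR (complex.Re ((V *m A *m adj V) i i)) p <= \sum_i powR (d i) p.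
Proof.
move=> p1 h d0 hV; under eq_bigr do rewrite (diag_conj _ _ h) /=.
have hW : V *m adj P *m adj (V *m adj P) *m (V *m adj P) = V *m adj P.
  case: h => hP _; rewrite adjM adjK.
  by rewrite !mulmxA -(mulmxA V (adj P) P) (unitaryC hP) mulmx1 hV.
apply: sum_powR_substochastic => // [i j|i|j].
- exact: normsq_ge0.
- exact: partial_isometry_row_le1.
- exact: partial_isometry_col_le1.
Qed.

(* [V] is the partial isometry [diag(s)^-1 P A B] of right singular vectors of
   [A B], where [0^-1 = 0] discards the kernel. *)
Lemma singular_defect n (A B P : 'M[C]_n) d : adj A = A -> adj B = B ->
  diagonalizes P d ((A *m B) *m adj (A *m B)) -> (forall i, 0 <= d i) ->
  exists V : 'M[C]_n, V *m adj V *m V = V /\ forall i,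
    complex.Re ((P *m (A *m A) *m adj P) i i) + complex.Re ((V *m (B *m B) *m adj V) i i)
    = 2 * Num.sqrt (d i) + \sum_j normsq ((P *m A - V *m B) i j).
Proof.
move=> hA hB [hP hd] d0; set X := A *m B in hd.
pose s i := Num.sqrt (d i).
have ssd i : d i = s i * s i by rewrite -expr2 sqr_sqrtr.
have hdP : P *m X *m adj (P *m X) = rdiag d.
  by rewrite adjM mulmxA -(mulmxA P) hd !mulmxA hP mul1mx -mulmxA hP mulmx1.
pose V := rdiag (fun i => (s i)^-1) *m (P *m X).
(* This is [diag(s)^-1 diag(s^2)]; where [s i = 0] both sides are 0. *)
have hVX : V *m adj (P *m X) = rdiag s.
  rewrite /V -mulmxA hdP mul_rdiag; apply: eq_rdiag => i; rewrite ssd.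
  by have [->|sn0] := eqVneq (s i) 0; rewrite ?mulr0 // mulKf.
exists V; split.
  (* [V V^+ = diag(s) diag(s)^-1] is the indicator of [s i != 0]; it fixes [V] because the other
     rows of [V] vanish. *)
  rewrite {2}/V adjM adj_rdiag mulmxA hVX {1}/V mulmxA !mul_rdiag /V.
  congr (_ *m _); apply: eq_rdiag => i.
  have [->|sn0] := eqVneq (s i) 0; first by rewrite invr0 mulr0.
  by rewrite divff // mul1r.
clearbody V; move=> i; apply: (@complexI R).
have -> : (2 * Num.sqrt (d i) + \sum_j normsq ((P *m A - V *m B) i j))%:C
    = 2 * (s i)%:C + ((P *m A - V *m B) *m adj (P *m A - V *m B)) i i.
  by rewrite mulmx_adj_diag !rmorphD rmorphM /= rmorph_nat.
have -> : (P *m A - V *m B) *m adj (P *m A - V *m B) =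
    P *m (A *m A) *m adj P + V *m (B *m B) *m adj V - rdiag s - rdiag s.
  (* Both cross terms are [diag(s)]: this one is [V (P X)^+], and the other is its adjoint. *)
  have e1 : V *m B *m adj (P *m A) = rdiag s.
    by rewrite -hVX !adjM hA hB !mulmxA.
  have e2 : P *m A *m adj (V *m B) = rdiag s.
    by rewrite -adj_rdiag -e1 (adjM (V *m B)) adjK.
  rewrite adjB mulmxBr !mulmxBl e1 e2 !adjM hA hB !mulmxA.
  by rewrite opprB addrACA addrA.
(* These diagonal entries are real, so taking [complex.Re] loses nothing. *)
have re (Y : 'M[C]_n) : exists x : R, (Y *m adj Y) i i = x%:C.
  by rewrite mulmx_adj_diag; eexists.
have [x] := re (P *m A); have [y] := re (V *m B).
rewrite !adjM hA hB.
have -> : P *m A *m (A *m adj P) = P *m (A *m A) *m adj P by rewrite !mulmxA.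
have -> : V *m B *m (B *m adj V) = V *m (B *m B) *m adj V by rewrite !mulmxA.
move: (P *m (A *m A) *m adj P) (V *m (B *m B) *m adj V) => X1 X2 eY eX.
have -> : (X1 + X2 - rdiag s - rdiag s) i i = X1 i i + X2 i i - (s i)%:C - (s i)%:C.
  by rewrite !mxE eqxx mulr1n.
rewrite eX eY [LHS]rmorphD; ring.
Qed.

End TraceInequality.

(** * The trace inequality and its equality case *)

Section Fidelity.
Variable R : realType.
Local Notation C := R[i].

(** Hermitian [A] and [B] stand for the two square roots; [S], [T1], [T2] are the [p]-th powers of
    the Schatten norms of [A B], [A^2], [B^2]. *)
Lemma sum_powR_mul_le n p (A B P P1 P2 : 'M[C]_n) d d1 d2 :
  1 <= p -> adj A = A -> adj B = B ->
  diagonalizes P d ((A *m B) *m adj (A *m B)) -> (forall i, 0 <= d i) ->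
  diagonalizes P1 d1 (A *m A) -> (forall i, 0 <= d1 i) ->
  diagonalizes P2 d2 (B *m B) -> (forall i, 0 <= d2 i) ->
  let S := \sum_i powR (d i) (p / 2) in
  let T1 := \sum_i powR (d1 i) p in
  let T2 := \sum_i powR (d2 i) p in
  S <= (T1 + T2) / 2 /\
  (S = (T1 + T2) / 2 -> \tr (A *m A) = \tr (B *m B) -> A *m A = B *m B).
Proof.
move=> p1 hA hB hd d0 hd1 d10 hd2 d20 S T1 T2; have p0 : 0 < p by lra.
have [V [hV ab]] := singular_defect hA hB hd d0.
have hP := unitaryC hd.1.
have hPP : P *m adj P *m P = P by rewrite -mulmxA hP mulmx1.
pose a i := complex.Re ((P *m (A *m A) *m adj P) i i).
pose b i := complex.Re ((V *m (B *m B) *m adj V) i i).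
pose z i := \sum_j normsq ((P *m A - V *m B) i j).
have {}ab i : a i + b i = 2 * Num.sqrt (d i) + z i := ab i.
have ha : \sum_i powR (a i) p <= T1 := sum_powR_diag_le p1 hd1 d10 hPP.
have hb : \sum_i powR (b i) p <= T2 := sum_powR_diag_le p1 hd2 d20 hV.
have z0 i : 0 <= z i by apply: sumr_ge0 => j _; exact: normsq_ge0.
have diag0 (X Y : 'M[C]_n) i : adj X = X ->
    0 <= complex.Re ((Y *m (X *m X) *m adj Y) i i).
  move=> hX; have -> : Y *m (X *m X) *m adj Y = Y *m X *m adj (Y *m X).
    by rewrite adjM hX !mulmxA.
  by rewrite mulmx_adj_diag /= sumr_ge0 // => j _; exact: normsq_ge0.
have a0 i : 0 <= a i by exact: diag0.
have b0 i : 0 <= b i by exact: diag0.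
have z_eq0 : (forall i, z i = 0) -> P *m A = V *m B.
  move=> h; apply/eqP; rewrite -subr_eq0; apply/eqP.
  by apply: mulmx_adj_diag_eq0 => i; rewrite mulmx_adj_diag; congr (_%:C); exact: h.
clearbody a b z.
have abz i : (a i + b i) / 2 = Num.sqrt (d i) + z i / 2.
  by have := ab i; lra.
have s0 i : 0 <= Num.sqrt (d i) by exact: sqrtr_ge0.
have sm i : Num.sqrt (d i) <= (a i + b i) / 2 by have := z0 i; rewrite abz; lra.
have m0 i : 0 <= (a i + b i) / 2 by exact: le_trans (s0 i) (sm i).
have Sm i : powR (d i) (p / 2) <= powR ((a i + b i) / 2) p.
  by rewrite -powR_sqrt // ge0_ler_powR ?nnegrE // ltW.
have mT : \sum_i powR ((a i + b i) / 2) p <= (T1 + T2) / 2.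
  apply: le_trans (_ : \sum_i (powR (a i) p + powR (b i) p) / 2 <= _).
    by apply: ler_sum => i _; exact: powR_midpoint.
  by rewrite -mulr_suml big_split /= ler_wpM2r ?invr_ge0 // lerD.
split=> [|eqS trAB]; first by apply: le_trans mT; apply: ler_sum.
(* Equality makes each nonnegative summand of the difference vanish; injectivity of [powR] then
   gives [z i = 0]. *)
have Z0 : P *m A = V *m B.
  apply: z_eq0 => i.
  have : \sum_i (powR ((a i + b i) / 2) p - powR (d i) (p / 2)) <= 0.
    by rewrite sumrB subr_le0 -/S eqS.
  move=> le0; have /eqP : \sum_i (powR ((a i + b i) / 2) p - powR (d i) (p / 2)) = 0.
    by apply/eqP; rewrite eq_le le0 sumr_ge0 // => k _; rewrite subr_ge0.
  rewrite psumr_eq0 => [/allP/(_ i)|k _]; last by rewrite subr_ge0.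
  rewrite mem_index_enum => /(_ isT) /=; rewrite subr_eq0 -powR_sqrt // => /eqP.
  move/powR_injective; rewrite !nnegrE => /(_ p0 (m0 i) (s0 i)).
  by have := abz i; lra.
(* Insert [P^+ P = 1] between the two factors [A]. *)
have eAA : A *m A = B *m adj V *m (V *m B).
  have -> : B *m adj V = A *m adj P by rewrite -{1}hB -adjM -Z0 adjM hA.
  by rewrite -Z0 !mulmxA -(mulmxA A) hP mulmx1.
have hVV : adj V *m V *m adj V = adj V.
  by have := congr1 (@adj R n n) hV; rewrite !adjM !adjK mulmxA.
(* Since [V^+ V] is a projection, the squared Frobenius norm of [B - B V^+ V] is
   [tr (B^2 - A^2) = 0]. *)
have : B - B *m adj V *m V = 0.
  apply: mxtrace_mulmx_adj_eq0.
  suff -> : (B - B *m adj V *m V) *m adj (B - B *m adj V *m V) = B *m B - A *m A.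
    by rewrite linearB /= trAB subrr.
  rewrite adjB !adjM adjK hB mulmxBr !mulmxBl eAA.
  have -> : B *m adj V *m V *m (adj V *m (V *m B)) = B *m adj V *m (V *m B).
    by rewrite !mulmxA -(mulmxA B) -(mulmxA B) hVV !mulmxA.
  by rewrite !mulmxA subrr subr0.
by move/eqP; rewrite subr_eq0 => /eqP eB; rewrite eAA mulmxA -eB.
Qed.

(** * Square roots and Schatten norms of states *)

Lemma sqrtm_hermitian n (A : 'M[C]_n) : psd A -> adj (sqrtm A) = sqrtm A.
Proof.
by move=> /psd_diagonalizes[P [d [h d0]]]; exact: diagonalizes_adj (sqrtm_diag d0 h).
Qed.

Lemma sqrtmK n (A : 'M[C]_n) : psd A -> sqrtm A *m sqrtm A = A.
Proof.
move=> /psd_diagonalizes[P [d [h d0]]]; have hs := sqrtm_diag d0 h.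
have [_ ->] := diagonalizes_mul hs hs; case: h => _ ->.
by congr (_ *m _ *m _); apply: eq_rdiag => i; rewrite -expr2 sqr_sqrtr.
Qed.

Lemma sqrtm_conj n (U A : 'M[C]_n) : unitary U -> psd A ->
  sqrtm (U *m A *m adj U) = U *m sqrtm A *m adj U.
Proof.
move=> hU /psd_diagonalizes[P [d [h d0]]].
have [_ ->] := sqrtm_diag d0 (diagonalizes_conj hU h).
by have [_ ->] := diagonalizes_conj hU (sqrtm_diag d0 h).
Qed.

Lemma schatten_conj n p (U X : 'M[C]_n) : unitary U ->
  schatten p (U *m X *m adj U) = schatten p X.
Proof.
move=> hU; have [P [d [h d0]]] := psd_diagonalizes (psd_mulmx_adj X).
rewrite (schatten_diag _ h); apply: (@schatten_diag _ _ _ _ (P *m adj U)).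
have -> : U *m X *m adj U *m adj (U *m X *m adj U) = U *m (X *m adj X) *m adj U.
  by rewrite !adjM adjK !mulmxA -(mulmxA _ (adj U) U) (unitaryC hU) mulmx1.
exact: diagonalizes_conj.
Qed.

Lemma schatten_ge0 n p (X : 'M[C]_n) : 0 <= schatten p X.
Proof. exact: powR_ge0. Qed.

Lemma schatten_eq0 n p (X : 'M[C]_n) : 0 < p -> (schatten p X == 0) = (X == 0).
Proof.
move=> p0; have [P [d [h d0]]] := psd_diagonalizes (psd_mulmx_adj X).
have p20 : p / 2 != 0 by rewrite gt_eqF // divr_gt0.
rewrite (schatten_diag _ h) powR_eq0 div1r invr_eq0 (gt_eqF p0) andbT.
rewrite psumr_eq0 => [|i _]; last exact: powR_ge0.
apply/idP/eqP => [/allP hd|X0].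
  apply: mulmx_adj_eq0; case: h => _ ->.
  suff -> : rdiag d = 0 by rewrite mulmx0 mul0mx.
  apply/matrixP => i j; rewrite rdiagE mxE.
  have := hd i; rewrite mem_index_enum => /(_ isT) /=.
  by rewrite powR_eq0 p20 andbT => /eqP->; rewrite mul0rn.
apply/allP => i _; rewrite /= powR_eq0 p20 andbT.
have : P *m (X *m adj X) *m adj P = rdiag d.
  by case: h => hP ->; rewrite !mulmxA hP mul1mx -mulmxA hP mulmx1.
rewrite X0 mul0mx mulmx0 mul0mx => /matrixP/(_ i i).
by rewrite mxE rdiagE eqxx mulr1n => /complexI <-.
Qed.

(** Trace one excludes [A = 0]; this keeps the denominator of [Fp] positive. *)
Lemma schatten_density_gt0 n p (A : 'M[C]_n) : 0 < p -> density A -> 0 < schatten p A.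
Proof.
move=> p0 [_ trA]; rewrite lt_neqAle schatten_ge0 andbT eq_sym schatten_eq0 //.
by apply/eqP => A0; move: trA; rewrite A0 mxtrace0 => /eqP; rewrite eq_sym oner_eq0.
Qed.

(** The mean of the two power sums is at most their maximum, and [x^(1/p)] is monotone and
    injective. If [S] reaches the maximum it also equals the mean, which is the equality case of
    [sum_powR_mul_le]. *)
Lemma schatten_sqrtm_le n p (A B : 'M[C]_n) : 1 <= p -> psd A -> psd B ->
  schatten p (sqrtm A *m sqrtm B) <= Num.max (schatten p A) (schatten p B) /\
  (\tr A = \tr B ->
   schatten p (sqrtm A *m sqrtm B) = Num.max (schatten p A) (schatten p B) -> A = B).
Proof.
move=> p1 hA hB; have p0 : 0 < p by lra.
have [P1 [d1 [h1 d10]]] := psd_diagonalizes hA.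
have [P2 [d2 [h2 d20]]] := psd_diagonalizes hB.
have [P [d [h d0]]] := psd_diagonalizes (psd_mulmx_adj (sqrtm A *m sqrtm B)).
rewrite (schatten_diag p h) (schatten_hermitian p h1 d10) (schatten_hermitian p h2 d20).
move: (sqrtm_hermitian hA) (sqrtm_hermitian hB) (sqrtmK hA) (sqrtmK hB) h.
move: (sqrtm A) (sqrtm B) => a b ha hb aa bb h.
rewrite -aa in h1; rewrite -bb in h2.
have := sum_powR_mul_le p1 ha hb h d0 h1 d10 h2 d20; rewrite /= aa bb.
have S0 : 0 <= \sum_i powR (d i) (p / 2) by apply: sumr_ge0 => i _; exact: powR_ge0.
have T10 : 0 <= \sum_i powR (d1 i) p by apply: sumr_ge0 => i _; exact: powR_ge0.
have T20 : 0 <= \sum_i powR (d2 i) p by apply: sumr_ge0 => i _; exact: powR_ge0.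
move: (\sum_i _) (\sum_i powR (d1 i) _) (\sum_i powR (d2 i) _) S0 T10 T20 => S T1 T2 S0 T10 T20.
move=> [leS eqS]; have ip0 : 0 < 1 / p by rewrite divr_gt0.
have mono x y : 0 <= x -> 0 <= y -> x <= y -> powR x (1 / p) <= powR y (1 / p).
  by move=> x0 y0 xy; rewrite ge0_ler_powR ?nnegrE // ltW.
have inj x y : 0 <= x -> 0 <= y -> powR x (1 / p) = powR y (1 / p) -> x = y.
  by move=> x0 y0; apply: powR_injective; rewrite ?nnegrE.
have [T12|/ltW T21] := leP T1 T2.
  rewrite max_r; last exact: mono.
  split=> [|trAB /(inj _ _ S0 T20) eS]; first by apply: mono => //; lra.
  by apply: eqS => //; lra.
rewrite max_l; last exact: mono.
split=> [|trAB /(inj _ _ S0 T10) eS]; first by apply: mono => //; lra.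
by apply: eqS => //; lra.
Qed.

(** * Properties of the fidelity *)

Lemma FpE n p (A B : 'M[C]_n) : Fp p A B =
  (schatten p (sqrtm A *m sqrtm B) / Num.max (schatten p A) (schatten p B)) ^+ 2.
Proof.
have a0 := schatten_ge0 p A; have b0 := schatten_ge0 p B.
rewrite /Fp; set s := schatten p (_ *m _).
move: s (schatten p A) (schatten p B) a0 b0 => s a b a0 b0.
rewrite expr_div_n; congr (s ^+ 2 / _).
by have [ab|/ltW ab] := leP a b; [rewrite max_l|rewrite max_r] => //; rewrite lerXn2r ?nnegrE.
Qed.

(** Exchanging the two roots gives the adjoint product, which has the same Schatten norm. *)
Lemma FpC n p (A B : 'M[C]_n) : 0 < p -> psd A -> psd B -> Fp p A B = Fp p B A.
Proof.
move=> p0 hA hB; rewrite (FpE p A B) (FpE p B A).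
move: (schatten p A) (schatten p B) (sqrtm_hermitian hA) (sqrtm_hermitian hB) => x y.
move: (sqrtm A) (sqrtm B) => a b ha hb.
by have := schatten_adj (a *m b) p0; rewrite adjM ha hb maxC => ->.
Qed.

Lemma sqrtm_mul_eq0 n (A B : 'M[C]_n) : psd A -> psd B ->
  (sqrtm A *m sqrtm B = 0 <-> A *m B = 0).
Proof.
move=> hA hB.
move: (sqrtm_hermitian hA) (sqrtm_hermitian hB) (sqrtmK hA) (sqrtmK hB).
move: (sqrtm A) (sqrtm B) => a b ha hb aa bb; split=> h.
  by rewrite -aa -bb mulmxA -(mulmxA a) h mulmx0 mul0mx.
(* One root is removed at a time: [(A b)(A b)^+ = A B A = 0], then [(b a)(b a)^+ = b A b = 0]. *)
have /mulmx_adj_eq0 Ab : (A *m b) *m adj (A *m b) = 0.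
  by rewrite adjM hb mulmxA -(mulmxA A) bb h mul0mx.
have /mulmx_adj_eq0 ba : (b *m a) *m adj (b *m a) = 0.
  by rewrite adjM ha hb mulmxA -(mulmxA b) aa -mulmxA Ab mulmx0.
by have := congr1 (@adj R n n) ba; rewrite adjM ha hb => ->; rewrite adjE trmx0 map_mx0.
Qed.

Lemma rank1_mulmxE n (A : 'M[C]_n) : \rank A = 1%N ->
  exists (x : 'cV[C]_n) (y : 'rV[C]_n), A = x *m y.
Proof.
have := mulmx_base A; move: (col_base A) (row_base A).
by move: (\rank A) => r x y <- r1; subst r; exists x, y.
Qed.

(** With [A = x y], the middle factor [y B x] is a scalar, equal to [tr (A B)] by cyclicity. *)
Lemma rank1_sandwich n (A B : 'M[C]_n) : \rank A = 1%N ->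
  A *m B *m A = \tr (A *m B) *: A.
Proof.
move=> /rank1_mulmxE[x [y ->]].
have -> : x *m y *m B *m (x *m y) = x *m (y *m B *m x) *m y by rewrite !mulmxA.
have -> : \tr (x *m y *m B) = (y *m B *m x) 0 0.
  by rewrite -mulmxA mxtrace_mulC trace_mx11.
by rewrite {1}[y *m B *m x]mx11_scalar mul_mx_scalar scalemxAl.
Qed.

(** A pure [A] is its own square root and has norm 1, which no density matrix exceeds. With
    [b = sqrtm B], [(A b)(A b)^+ = tr (A B) A], so the squared norm in the numerator is
    [tr (A B)]. *)
Lemma Fp_pure n p (A B : 'M[C]_n) : 1 <= p -> pure_state A -> density A -> density B ->
  (Fp p A B)%:C = \tr (A *m B).
Proof.
move=> p1 [_ [AA rA]] [hA trA] [hB trB]; have p0 : 0 < p by lra.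
have [P1 [d1 [h1 d10]]] := psd_diagonalizes hA.
have [P2 [d2 [h2 d20]]] := psd_diagonalizes hB.
have [P [d [h d0]]] := psd_diagonalizes (psd_mulmx_adj (A *m sqrtm B)).
have d1E i : d1 i = 0 \/ d1 i = 1.
  have : d1 i * d1 i = d1 i.
    apply: (@complexI R); have := diagonalizes_mul h1 h1; rewrite AA => -[hP e].
    have := e; rewrite {1}(proj2 h1).
    move/(congr1 (fun M => P1 *m M *m adj P1)).
    rewrite !mulmxA hP !mul1mx -!mulmxA hP !mulmx1 => /matrixP/(_ i i).
    by rewrite !rdiagE eqxx !mulr1n.
  move/eqP; rewrite -subr_eq0 -[X in _ - X]mulr1 -mulrBr mulf_eq0 subr_eq0.
  by case/orP => /eqP; [left|right].
have sA : sqrtm A = A.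
  have [_ ->] := sqrtm_diag d10 h1; case: h1 => _ ->.
  congr (_ *m _ *m _); apply: eq_rdiag => i.
  by case: (d1E i) => ->; rewrite ?sqrtr0 ?sqrtr1.
have sum1 : \sum_i d1 i = 1.
  by apply: (@complexI R); rewrite -(diagonalizes_trace h1) trA.
have sum2 : \sum_i d2 i = 1.
  by apply: (@complexI R); rewrite -(diagonalizes_trace h2) trB.
have nA : schatten p A = 1.
  rewrite (schatten_hermitian p h1 d10) (eq_bigr d1) ?sum1 ?powR1 // => i _.
  by case: (d1E i) => ->; rewrite ?powR1 ?powR0 // gt_eqF.
have nB : schatten p B <= 1.
  have one : powR (1 : R) (1 / p) = 1 by rewrite powR1.
  rewrite (schatten_hermitian p h2 d20) -[leRHS]one.
  rewrite ge0_ler_powR ?nnegrE ?divr_ge0 ?(ltW p0) //.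
    by apply: sumr_ge0 => i _; exact: powR_ge0.
  (* Eigenvalues of a density matrix lie in [[0, 1]], where [x^p <= x], so the power sum is at most
     the trace. *)
  rewrite -sum2; apply: ler_sum => i _.
  have [->|di0] := eqVneq (d2 i) 0; first by rewrite powR0 // gt_eqF.
  apply: ge1r_powR => //; rewrite lt_neqAle eq_sym di0 d20 /= -sum2 (bigD1 i) //=.
  by rewrite lerDl sumr_ge0.
have XX : (A *m sqrtm B) *m adj (A *m sqrtm B) = \tr (A *m B) *: A.
  rewrite adjM (sqrtm_hermitian hB) (diagonalizes_adj h1) mulmxA -(mulmxA A) (sqrtmK hB).
  exact: rank1_sandwich.
(* Being the trace of [(A b)(A b)^+], [tr (A B)] is real and nonnegative. *)
have trE : \tr (A *m B) = (\sum_i d i)%:C.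
  by rewrite -(diagonalizes_trace h) XX linearZ /= trA mulr1.
have c0 : 0 <= \sum_i d i by apply: sumr_ge0.
move: (\sum_i d i) c0 trE => c c0 trE.
have hX : diagonalizes P1 (fun i => c * d1 i) ((A *m sqrtm B) *m adj (A *m sqrtm B)).
  rewrite XX trE; case: h1 => hP e; split=> //; rewrite {1}e scalemxAl scalemxAr.
  by congr (_ *m _ *m _); apply/matrixP => i j; rewrite mxE !rdiagE rmorphM mulrnAr.
rewrite FpE sA nA max_l // divr1 (schatten_diag _ hX) trE.
have p20 : p / 2 != 0 by rewrite gt_eqF // divr_gt0.
rewrite (eq_bigr (fun i => powR c (p / 2) * d1 i)); last first.
  by move=> i _; case: (d1E i) => ->; rewrite ?mulr1 // !mulr0 powR0.
(* [(c^(p/2))^(1/p)] is [sqrt c], whose square is [c]. *)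
rewrite -mulr_sumr sum1 mulr1 -powR_sqrt // -powRrM mulrC divfK ?gt_eqF //.
by rewrite powRr1 ?sqrtr_ge0 // sqr_sqrtr.
Qed.

Lemma max_schatten_gt0 n p (A B : 'M[C]_n) : 0 < p -> density A ->
  0 < Num.max (schatten p A) (schatten p B).
Proof.
move=> p0 hA; have := schatten_density_gt0 p0 hA.
move: (schatten p A) (schatten p B) => x y x0.
by rewrite lt_max x0.
Qed.

Lemma Fp_ge0_le1 n p (A B : 'M[C]_n) : 1 <= p -> density A -> density B ->
  0 <= Fp p A B <= 1.
Proof.
move=> p1 hA hB; have p0 : 0 < p by lra.
have m0 := max_schatten_gt0 B p0 hA.
have [] := schatten_sqrtm_le p1 hA.1 hB.1.
have := schatten_ge0 p (sqrtm A *m sqrtm B); rewrite FpE.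
move: (schatten p (sqrtm A *m sqrtm B)) (Num.max _ _) m0 => s m m0 s0 sm _.
by rewrite sqr_ge0 exprn_ile1 ?divr_ge0 ?(ltW m0) // ler_pdivrMr // mul1r.
Qed.

Lemma Fp_eq1 n p (A B : 'M[C]_n) : 1 <= p -> density A -> density B ->
  (Fp p A B = 1 <-> A = B).
Proof.
move=> p1 hA hB; have p0 : 0 < p by lra.
have m0 := max_schatten_gt0 B p0 hA.
have [_] := schatten_sqrtm_le p1 hA.1 hB.1; rewrite hA.2 hB.2 => /(_ erefl).
have := schatten_ge0 p (sqrtm A *m sqrtm B); rewrite FpE => s0 eqAB.
split=> [|AB]; last first.
  rewrite -AB in m0 *; rewrite (sqrtmK hA.1) maxxx in m0 *.
  by rewrite divff ?expr1n ?gt_eqF.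
move: (schatten p (sqrtm A *m sqrtm B)) (Num.max _ _) m0 s0 eqAB => s m m0 s0 eqAB.
move/eqP; rewrite sqrf_eq1 => /orP[/eqP sm|/eqP sm].
  by apply: eqAB; rewrite -[s](divfK (lt0r_neq0 m0)) sm mul1r.
(* The ratio is nonnegative, so it cannot be the root [-1]. *)
by have := divr_ge0 s0 (ltW m0); rewrite sm oppr_ge0 ler10.
Qed.

Lemma Fp_eq0 n p (A B : 'M[C]_n) : 0 < p -> density A -> density B ->
  (Fp p A B = 0 <-> A *m B = 0).
Proof.
move=> p0 hA hB; have m0 := max_schatten_gt0 B p0 hA.
have := schatten_eq0 (sqrtm A *m sqrtm B) p0.
rewrite FpE -(sqrtm_mul_eq0 hA.1 hB.1).
move: (schatten p (sqrtm A *m sqrtm B)) (Num.max _ _) m0 => s m m0 s0.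
split=> [/eqP|/eqP].
  by rewrite sqrf_eq0 mulf_eq0 invr_eq0 (gt_eqF m0) orbF s0 => /eqP.
by rewrite -s0 => /eqP->; rewrite mul0r expr0n.
Qed.

Lemma Fp_conj n p (U A B : 'M[C]_n) : unitary U -> psd A -> psd B ->
  Fp p (U *m A *m adj U) (U *m B *m adj U) = Fp p A B.
Proof.
move=> hU hA hB; rewrite (FpE p A B) FpE !(schatten_conj p _ hU).
rewrite (sqrtm_conj hU hA) (sqrtm_conj hU hB).
rewrite -(schatten_conj p (sqrtm A *m sqrtm B) hU).
by rewrite !mulmxA -(mulmxA _ (adj U) U) (unitaryC hU) mulmx1.
Qed.

End Fidelity.

Unset Implicit Arguments.

Theorem theorem2 (R : realType) (n : nat) (p : R) (hp : 1 <= p) :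
  forall rho sigma : 'M[R[i]]_n, density rho -> density sigma ->
    [/\ 0 <= Fp p rho sigma <= 1,
         (Fp p rho sigma = 1 <-> rho = sigma)
         & (Fp p rho sigma = 0 <-> rho *m sigma = 0)] /\
    [/\ Fp p rho sigma = Fp p sigma rho,
         (pure_state rho \/ pure_state sigma ->
            (Fp p rho sigma)%:C = \tr (rho *m sigma)) &
         (forall U : 'M[R[i]]_n, unitary U ->
            Fp p (U *m rho *m adj U) (U *m sigma *m adj U) = Fp p rho sigma)].
Proof.
move=> rho sigma hr hs; have p0 : 0 < p by exact: lt_le_trans hp.
split; split.
- exact: Fp_ge0_le1.
- exact: Fp_eq1.
- exact: Fp_eq0.
- exact: FpC p0 hr.1 hs.1.
- move=> [hpr|hps]; first exact: Fp_pure.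
  (* A pure [sigma] reduces to the previous case by symmetry of [Fp] and cyclicity of the trace. *)
  by rewrite (FpC p0 hr.1 hs.1) mxtrace_mulC; exact: Fp_pure.
- by move=> U hU; apply: Fp_conj hU hr.1 hs.1.
Qed.
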